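(* Let $q\ge 1$. Suppose that for all $\omega\in\Omega$ the nominal frequency responses $\overline{P}_\ell(j\omega)\in\mathbb{C}$ of the systems $P_\ell$, $\ell\in\{1,2\}$, are given, and let $\overline{R}_\ell(\omega)=\phi^{-1}(\overline{P}_\ell(j\omega))$ be their inverse stereographic projections onto the Riemann sphere. Let $\mathbb{P}_{R_\ell(\omega)}$ be the probability distribution governing the projected uncertainty of $P_\ell(j\omega)$ on the Riemann sphere. Then $$\mathrm{d}_q(P_1,P_2)\ \ge\ \sup_{\omega\in\Omega}\ \inf_{\pi_\omega\in\Pi_\omega}\ \Delta_{\mathrm{dev}}(\omega),$$ where $$\Delta_{\mathrm{dev}}(\omega)=\left(\mathrm{d_{chord}}(\overline{R}_1(\omega),\overline{R}_2(\omega))-\mathbb{E}\left[\Delta_{\mathrm{nom}}(\omega)\right]\right)_+^{q},\qquad \Delta_{\mathrm{nom}}(\omega)=\sum_{\ell=1}^{2}\mathrm{d_{chord}}(r_\ell(\omega),\overline{R}_\ell(\omega)),$$ and the expectation is taken with respect to $(r_1(\omega),r_2(\omega))\sim\pi_\omega$.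
   Context: $\Omega = [0,\infty)$ is the set of frequencies and $(\cdot)_+=\max(0,\cdot)$, so $(x)_+^q=(\max(0,x))^q$. The Riemann sphere is $\partial\mathfrak{R} = \{(x,y,z)\in\mathbb{R}^3 : x^2+y^2+(z-\tfrac12)^2=\tfrac14\}$. The inverse stereographic projection $\phi^{-1}:\mathbb{C}\to\partial\mathfrak{R}$ is $$\phi^{-1}(c) = \left(\frac{\mathrm{Re}(c)}{1+|c|^2},\frac{\mathrm{Im}(c)}{1+|c|^2},\frac{|c|^2}{1+|c|^2}\right),$$ and the chordal distance on $\partial\mathfrak{R}$ is $\mathrm{d_{chord}}(r_1,r_2)=\|r_1-r_2\|$ (Euclidean norm in $\mathbb{R}^3$). Two stochastic SISO LTI systems $P_1,P_2$ are given. For every $\omega\in\Omega$ the frequency response $P_\ell(j\omega)$ is a complex random variable with distribution $\mathbb{P}_{P_\ell(\omega)}$ whose support set $\mathcal{S}_{P_\ell}(\omega)\subset\mathbb{C}$ is convex and compact. The projected support set is $\mathcal{R}_{P_\ell}(\omega)=\phi^{-1}(\mathcal{S}_{P_\ell}(\omega))$, and $\mathbb{P}_{R_\ell(\omega)}$ is the push-forward of $\mathbb{P}_{P_\ell(\omega)}$ under $\phi^{-1}$. $\Pi_\omega=\Pi(\mathbb{P}_{R_1(\omega)},\mathbb{P}_{R_2(\omega)})$ is the set of all joint distributions with marginals $\mathbb{P}_{R_1(\omega)}$ and $\mathbb{P}_{R_2(\omega)}$. The type-$q$ distance is $$\mathrm{d}_q(P_1,P_2) := \sup_{\omega\in\Omega}\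 \inf_{\pi_\omega\in\Pi_\omega}\int_{\mathcal{R}_{P_1}(\omega)\times\mathcal{R}_{P_2}(\omega)}\mathrm{d_{chord}}(r_1,r_2)^q\,\pi_\omega(dr_1,dr_2)$$ (no $q$-th root is taken). *)

(* Defs.v *)
From HB Require Import structures.
From mathcomp Require Import all_boot all_order all_algebra complex.
From mathcomp Require Import ring lra.
From mathcomp Require Import all_classical all_reals all_analysis.

Set Implicit Arguments.
Unset Strict Implicit.
Unset Printing Implicit Defensive.

Import Order.TTheory GRing.Theory Num.Theory numFieldNormedType.Exports.

Local Open Scope classical_set_scope.
Local Open Scope ring_scope.

(* The library puts the norm topology on [R[i]^o] only; it is transported to
   [R[i]], which is then equipped with its Borel sigma-algebra. *)
HB.instance Definition _ (R : realType) := NormedModule.copy R[i] R[i]^o.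
HB.instance Definition _ (R : realType) :=
  Measurable.copy R[i] (g_sigma_algebraType (@open R[i])).

Definition frequencies (R : realType) : set R := [set w | 0 <= w].

(* The product sigma-algebra of [R * R * R] is the Borel sigma-algebra of R^3;
   the library norm on this product is the sup norm, so the Euclidean distance
   is spelled out below. *)
Notation space3 R := (R * R * R)%type.

Definition riemann_sphere (R : realType) : set (space3 R) :=
  [set r : space3 R | r.1.1 ^+ 2 + r.1.2 ^+ 2 + (r.2 - 2^-1) ^+ 2 = 4^-1].

Definition inv_stereo (R : realType) (c : R[i]) : space3 R :=
  (complex.Re c / (1 + Normc.normc c ^+ 2),
   complex.Im c / (1 + Normc.normc c ^+ 2),
   Normc.normc c ^+ 2 / (1 + Normc.normc c ^+ 2)).

Definition chord_dist (R : realType) (r s : space3 R) : R :=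
  Num.sqrt ((r.1.1 - s.1.1) ^+ 2 + (r.1.2 - s.1.2) ^+ 2 + (r.2 - s.2) ^+ 2).

Section inv_stereo_lemmas.
Context {R : realType}.
Implicit Types c : R[i].

Lemma sqr_normcE c :
  Normc.normc c ^+ 2 = complex.Re c ^+ 2 + complex.Im c ^+ 2.
Proof. by case: c => a b /=; rewrite sqr_sqrtr// addr_ge0// sqr_ge0. Qed.

Lemma inv_stereo_denom_gt0 c : 0 < 1 + Normc.normc c ^+ 2.
Proof. by rewrite ltr_pwDl// sqr_ge0. Qed.

Lemma inv_stereo_sphere c : riemann_sphere (inv_stereo c).
Proof.
have d0 := lt0r_neq0 (inv_stereo_denom_gt0 c).
rewrite /riemann_sphere /inv_stereo /= !expr_div_n.
move: d0; rewrite sqr_normcE.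
set a := complex.Re c; set b := complex.Im c => d0.
have -> : (a ^+ 2 + b ^+ 2) / (1 + (a ^+ 2 + b ^+ 2)) - 2^-1 =
          ((a ^+ 2 + b ^+ 2) - 1) / 2 / (1 + (a ^+ 2 + b ^+ 2)).
  by field.
by field.
Qed.

Lemma normc_bound_Re c : (`|complex.Re c|%:C)%C <= `|c|.
Proof. exact: normc_ge_Re. Qed.

Lemma normc_bound_Im c : (`|complex.Im c|%:C)%C <= `|c|.
Proof.
case: c => a b; rewrite normc_def lecR /= -sqrtr_sqr ler_wsqrtr//.
by rewrite lerDr sqr_ge0.
Qed.

Lemma continuous_complex_part (f : R[i] -> R) :
  {morph f : x y / x - y} -> (forall c, (`|f c|%:C)%C <= `|c|) -> continuous f.
Proof.
move=> fB fle c; apply/(@cvgrPdist_lt _ _ _ (nbhs c) (nbhs_filter c)) => e e0.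
have e0' : 0 < (e%:C)%C :> R[i] by rewrite ltcR.
exists (e%:C)%C => //= t /=.
by move=> /(le_lt_trans (fle _)); rewrite fB ltcR.
Qed.

Lemma continuous_Re : continuous (@complex.Re R : R[i] -> R).
Proof. by apply: continuous_complex_part normc_bound_Re => -[a b] [c d]. Qed.

Lemma continuous_Im : continuous (@complex.Im R : R[i] -> R).
Proof. by apply: continuous_complex_part normc_bound_Im => -[a b] [c d]. Qed.

Lemma continuous_sqr_normc :
  continuous (fun c : R[i] => Normc.normc c ^+ 2).
Proof.
rewrite (_ : (fun _ => _) =
    fun c : R[i] => complex.Re c ^+ 2 + complex.Im c ^+ 2); last first.
  by apply/funext => c; rewrite sqr_normcE.
move=> c; apply: (@cvgD _ R^o _ (nbhs c) (nbhs_filter c)).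
- by apply: (@cvgM _ _ (nbhs c) (nbhs_filter c)); exact: continuous_Re.
- by apply: (@cvgM _ _ (nbhs c) (nbhs_filter c)); exact: continuous_Im.
Qed.

Lemma continuous_div_denom (f : R[i] -> R) : continuous f ->
  continuous (fun c : R[i] => f c / (1 + Normc.normc c ^+ 2)).
Proof.
move=> cf c; apply: (@cvgM _ _ (nbhs c) (nbhs_filter c)); first exact: cf.
apply: (@cvgV _ _ (nbhs c) (nbhs_filter c)).
  by rewrite gt_eqF// inv_stereo_denom_gt0.
apply: (@cvgD _ R^o _ (nbhs c) (nbhs_filter c)); first exact: cvg_cst.
exact: continuous_sqr_normc.
Qed.

Lemma continuous_measurable_complex (f : R[i] -> R) :
  continuous f -> measurable_fun setT f.
Proof.
move=> /continuousP cf; apply: (measurability _ (measurable_realfun.RGenOInfty.measurableE R)).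
move=> _ [_ [a ->] <-]; rewrite setTI.
by apply: sub_sigma_algebra; apply: cf; exact: interval_open.
Qed.

Lemma measurable_inv_stereo : measurable_fun setT (@inv_stereo R).
Proof.
by do 2?apply: measurable_fun_pair; apply: continuous_measurable_complex;
  apply: continuous_div_denom;
  [exact: continuous_Re|exact: continuous_Im|exact: continuous_sqr_normc].
Qed.

HB.instance Definition _ :=
  @isMeasurableFun.Build _ _ _ _ (@inv_stereo R) measurable_inv_stereo.

End inv_stereo_lemmas.

(* The smallest closed set of full measure. *)
Definition support_set (R : realType) (mu : set R[i] -> \bar R) : set R[i] :=
  [set c | forall U : set R[i], open U -> U c -> (0 < mu U)%E].

(* An LTI system enters only through its frequency response: [freq_resp P w] is
   the random variable P(jw).  Values at negative frequencies are never used. *)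
Record stoch_system (R : realType) := StochSystem {
  sample_display : measure_display ;
  sample_space : measurableType sample_display ;
  sample_prob : probability sample_space R ;
  freq_resp : R -> {mfun sample_space >-> R[i]} }.

Section type_q_distance.
Context {R : realType}.
Implicit Types (P : stoch_system R) (w q : R).

Definition resp_distr P w : probability R[i] R :=
  distribution (sample_prob P) (freq_resp P w).

Definition resp_support P w : set R[i] := support_set (resp_distr P w).

Definition proj_support P w : set (space3 R) :=
  @inv_stereo R @` resp_support P w.

Definition proj_distr P w : probability (space3 R) R :=
  distribution (resp_distr P w) (@inv_stereo R).

(* Joint laws live on R^3 x R^3; the marginal conditions concentrate them on the
   product of the two projected supports. *)
Definition couplings (mu nu : probability (space3 R) R) :
    set (probability (space3 R * space3 R)%type R) :=
  [set pi | forall A : set (space3 R), measurable A ->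
     pushforward pi fst A = mu A /\ pushforward pi snd A = nu A].

Definition proj_couplings P1 P2 w :=
  couplings (proj_distr P1 w) (proj_distr P2 w).

Local Open Scope ereal_scope.

Definition type_q_dist q P1 P2 : \bar R :=
  ereal_sup [set ereal_inf
    [set \int[pi]_(r in proj_support P1 w `*` proj_support P2 w)
           (chord_dist r.1 r.2 `^ q)%:E
    | pi in proj_couplings P1 P2 w] | w in @frequencies R].

Definition delta_nom (Rbar1 Rbar2 : space3 R) (r : space3 R * space3 R) : R :=
  (chord_dist r.1 Rbar1 + chord_dist r.2 Rbar2)%R.

Definition delta_dev q (Rbar1 Rbar2 : space3 R)
    (pi : probability (space3 R * space3 R)%type R) : \bar R :=
  maxe 0 ((chord_dist Rbar1 Rbar2)%:E - 'E_pi[delta_nom Rbar1 Rbar2]) `^ q.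

End type_q_distance.

(* Main.v *)
Require Import Defs.
From mathcomp Require Import all_boot all_order all_algebra complex.
From mathcomp Require Import ring.
From mathcomp Require Import all_classical all_reals all_analysis measurable_realfun.

Import Order.TTheory GRing.Theory Num.Theory numFieldNormedType.Exports.

Local Open Scope classical_set_scope.
Local Open Scope ring_scope.

Set Implicit Arguments.
Unset Strict Implicit.
Unset Printing Implicit Defensive.

(** Fix a frequency and a coupling of the two projected laws.  The triangle
    inequality for the chordal distance gives
    chord(Rbar1, Rbar2) <= chord(r1, r2) + delta_nom(r1, r2) for every pair
    (r1, r2); integrating against the coupling, the nominal distance minus the
    mean of delta_nom is at most the mean of chord(r1, r2).  The latter is
    nonnegative, so taking positive parts and raising to the power q preserves
    the bound, and by Jensen's inequality the q-th power of that mean is at most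
    the mean of chord(r1, r2)^q; this is [delta_dev_le].  Passing to the infimum
    over couplings and to the supremum over frequencies gives the theorem.

    What remains is that the cost in the type-q distance is integrated over the
    product of the projected supports only, while [delta_dev_le] bounds the
    integral over the whole space.  The two integrals agree because a coupling
    gives the complement of that product measure zero
    ([coupling_integral_setX]).  For this, the projected supports must be
    measurable, which holds since they are continuous images of compact sets,
    and they must carry the whole marginal mass ([proj_distr_supportC]), which
    holds because the complex plane has a countable base: the complement of a
    support is then a countable union of null open sets. *)

(** * Countable unions and countable bases *)

Lemma bigcup_unpickle (T : Type) (I : countType) (F : I -> set T) :
  \bigcup_i F i = \bigcup_n oapp F set0 (choice.unpickle n).
Proof.
apply/seteqP; split=> [x [i _ Fix]|x [n _]].
  by exists (choice.pickle i) => //; rewrite choice.pickleK.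
by case: (choice.unpickle n) => [i /= Fix|[]]; exists i.
Qed.

Lemma countType_bigcup_measurable d (T : measurableType d) (I : countType)
    (F : I -> set T) :
  (forall i, measurable (F i)) -> measurable (\bigcup_i F i).
Proof.
move=> mF; rewrite bigcup_unpickle; apply: bigcupT_measurable => n.
by case: (choice.unpickle n) => [i|]; [exact: mF|exact: measurable0].
Qed.

Lemma countType_bigcup_negligible d (T : measurableType d) (R : realType)
    (mu : {measure set T -> \bar R}) (I : countType) (F : I -> set T) :
  (forall i, mu.-negligible (F i)) -> mu.-negligible (\bigcup_i F i).
Proof.
move=> mF; rewrite bigcup_unpickle; apply: negligible_bigcup => n.
by case: (choice.unpickle n) => [i|]; [exact: mF|exact: negligible_set0].
Qed.

(** A base of a topology given as an indexed family, so that the index type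
    itself can carry the countability assumption. *)
Definition open_base (T : topologicalType) (I : Type) (B : I -> set T) :=
  (forall i, open (B i)) /\
  forall (U : set T) x, open U -> U x -> exists i, B i x /\ B i `<=` U.

Lemma open_base_bigcup (T : topologicalType) (I : Type) (B : I -> set T)
    (U : set T) :
  open_base B -> open U ->
  U = \bigcup_i (if `[< B i `<=` U >] then B i else set0).
Proof.
move=> [_ Bbase] oU; apply/seteqP; split=> [x Ux|x [i _]].
  have [i [Bix BiU]] := Bbase _ _ oU Ux.
  by exists i => //; rewrite asboolT.
by case: asboolP => [BiU /BiU|_ []].
Qed.

(** Stated through a map [f] because the topology and the sigma-algebra in
    question may sit on the same carrier without a common structure; [f] is then
    the identity. *)
Lemma open_base_measurable (T : topologicalType) d (T' : measurableType d)
    (f : T' -> T) (I : countType) (B : I -> set T) (U : set T) :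
  open_base B -> (forall i, measurable (f @^-1` B i)) ->
  open U -> measurable (f @^-1` U).
Proof.
move=> bB mB oU; rewrite (open_base_bigcup bB oU) preimage_bigcup.
apply: countType_bigcup_measurable => i.
by case: asboolP => _ //; rewrite preimage_set0.
Qed.

Definition rat_ball {R : realType} (p : rat * rat) : set R :=
  ball (ratr p.1 : R) (ratr p.2).

Lemma rat_ball_base {R : realType} : open_base (@rat_ball R).
Proof.
split=> [p|U x oU Ux]; first exact: ball_open.
have [c [r [/set_mem Bx BU]]] := open_subball_rat oU (mem_set Ux).
by exists (c, r).
Qed.

Lemma open_base_prod (T U : topologicalType) (I J : Type) (B : I -> set T)
    (C : J -> set U) :
  open_base B -> open_base C ->
  open_base (fun p : I * J => B p.1 `*` C p.2).
Proof.
move=> [oB bB] [oC bC]; split=> [[i j]/=|V [x y] oV Vxy].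
  rewrite openE => -[x y] /= [Bx Cy]; exists (B i, C j) => //=.
  by split; apply: open_nbhs_nbhs.
have : nbhs (x, y) V by exact: open_nbhs_nbhs.
case=> -[A A'] /= [] /=; rewrite !nbhsE => -[A1 [oA1 A1x] sA1] [A2 [oA2 A2y] sA2] AV.
have [i [Bix BiA]] := bB _ _ oA1 A1x.
have [j [Cjy CjA]] := bC _ _ oA2 A2y.
exists (i, j); split=> // -[u v] /= [Bu Cv].
by apply: AV; split=> /=; [exact/sA1/BiA|exact/sA2/CjA].
Qed.

Lemma continuous_fun_pair (T U V : topologicalType) (f : T -> U) (g : T -> V) :
  continuous f -> continuous g -> continuous (fun x => (f x, g x)).
Proof. by move=> cf cg x; exact: cvg_pair (cf x) (cg x). Qed.

(** * Borel sets of the complex plane and of the three-dimensional space *)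

Section borel.
Context {R : realType}.

Definition rat_box (p : (rat * rat) * (rat * rat) * (rat * rat)) :
    set (space3 R) :=
  (rat_ball p.1.1 `*` rat_ball p.1.2) `*` rat_ball p.2.

Lemma rat_box_base : open_base rat_box.
Proof.
exact: (open_base_prod (open_base_prod rat_ball_base rat_ball_base)
  rat_ball_base).
Qed.

Lemma measurable_rat_ball p : measurable (@rat_ball R p).
Proof. by apply: open_measurable; exact: ball_open. Qed.

Lemma open_measurable3 (U : set (space3 R)) : open U -> measurable U.
Proof.
move=> oU; apply: (@open_base_measurable (space3 R) _ (space3 R) id _ _ _
  rat_box_base _ oU) => p.
by do 2?apply: measurableX; exact: measurable_rat_ball.
Qed.

Lemma compact_measurable3 (K : set (space3 R)) : compact K -> measurable K.
Proof.
move=> cK; rewrite -[K]setCK; apply: measurableC; apply: open_measurable3.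
by apply: closed_openC; apply: compact_closed cK; exact: norm_hausdorff.
Qed.

Definition complex_box (p : (rat * rat) * (rat * rat)) : set R[i] :=
  [set c | rat_ball p.1 (complex.Re c) /\ rat_ball p.2 (complex.Im c)].

(** The modulus is at most the sum of the moduli of the real and imaginary
    parts, so a disc of radius r contains the points both of whose coordinates
    are within r / 2 of those of its centre. *)
Lemma complex_box_base : open_base complex_box.
Proof.
split=> [p|U c oU Uc].
  apply: (@openI _ (@complex.Re R @^-1` rat_ball p.1)
                   (@complex.Im R @^-1` rat_ball p.2)).
    by move/continuousP: (@continuous_Re R); apply; exact: ball_open.
  by move/continuousP: (@continuous_Im R); apply; exact: ball_open.
have : nbhs c U by exact: open_nbhs_nbhs.
case/nbhs_ballP => e e0 eU.
(* A positive radius in [R[i]] is a real number, because the order there compares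
   only numbers with equal imaginary parts. *)
have {eU} [r r0 rU] : exists2 r : R, 0 < r &
    forall z : R[i], Normc.normc (c - z) < r -> U z.
  move: e e0 eU => [a b]; rewrite /= ltcE /= => /andP[/eqP -> a0] eU.
  exists a => // z cz; apply: eU; rewrite /ball /= normc_def ltcR.
  by move: cz; case: (c - z).
have r2 : 0 < r / 2 by rewrite divr_gt0.
have [i [ic iU]] := (@rat_ball_base R).2 _ _ (ball_open (complex.Re c) (r / 2))
  (ballxx (complex.Re c) r2).
have [j [jc jU]] := (@rat_ball_base R).2 _ _ (ball_open (complex.Im c) (r / 2))
  (ballxx (complex.Im c) r2).
exists (i, j); split=> // z [/= /iU zi /jU zj]; apply: rU.
rewrite [ltRHS]splitr; apply: le_lt_trans (ltrD zi zj).
case: (c) (z) => [a b] [a' b'] /=.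
rewrite -[leRHS]ger0_norm ?addr_ge0// -sqrtr_sqr ler_wsqrtr//.
rewrite [leRHS]sqrrD !real_normK ?num_real// addrAC lerDl.
by rewrite mulrn_wge0// mulr_ge0.
Qed.

Lemma open_measurable_complex (U : set R[i]) : open U -> measurable U.
Proof. by move=> oU; apply: sub_sigma_algebra. Qed.

(** A point lies outside the support exactly when it has a null open
    neighbourhood, equivalently when it lies in a null box of the countable base. *)
Lemma negligible_support_setC (mu : probability R[i] R) :
  mu.-negligible (~` support_set mu).
Proof.
have -> : ~` support_set mu =
  \bigcup_p (if `[< mu (complex_box p) = 0%E >] then complex_box p else set0).
  apply/seteqP; split=> [c|c [p _]].
    move=> /existsNP[U] /not_implyP[oU] /not_implyP[Uc] /negP.
    rewrite -leNgt => muU.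
    have [p [pc pU]] := complex_box_base.2 _ _ oU Uc.
    exists p => //; rewrite asboolT//; apply/eqP; rewrite eq_le measure_ge0 andbT.
    apply: le_trans muU; apply: le_measure => //; rewrite inE.
      exact: open_measurable_complex (complex_box_base.1 p).
    exact: open_measurable_complex.
  case: asboolP => [mu0 pc|_ []] /(_ _ (complex_box_base.1 p) pc).
  by rewrite mu0 ltxx.
apply: countType_bigcup_negligible => p; case: asboolP => [mu0|_].
  exists (complex_box p); split => //.
  exact: open_measurable_complex (complex_box_base.1 p).
exact: negligible_set0.
Qed.

Lemma continuous_inv_stereo : continuous (@inv_stereo R).
Proof.
exact: (continuous_fun_pair (continuous_fun_pair
  (continuous_div_denom (@continuous_Re R))
  (continuous_div_denom (@continuous_Im R)))
  (continuous_div_denom (@continuous_sqr_normc R))).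
Qed.

(** * The chordal distance *)

Lemma measurable_chord_dist d (T : measurableType d) (f g : T -> space3 R) :
  measurable_fun setT f -> measurable_fun setT g ->
  measurable_fun setT (fun x => chord_dist (f x) (g x)).
Proof.
move=> mf mg; apply: (measurableT_comp (f := @Num.sqrt R)).
  by apply: continuous_measurable_fun; exact: sqrt_continuous.
have mfst d1 d2 (T1 : measurableType d1) (T2 : measurableType d2)
    (h : T -> T1 * T2) : measurable_fun setT h ->
  measurable_fun setT (fun x => (h x).1) /\
  measurable_fun setT (fun x => (h x).2).
  by move=> mh; split; apply: measurableT_comp.
have [[/mfst[f1 f2] f3] [/mfst[g1 g2] g3]] := (mfst _ _ _ _ _ mf, mfst _ _ _ _ _ mg).
by do 2?apply: measurable_funD; apply: measurable_funX; exact: measurable_funB.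
Qed.

Lemma chord_dist_ge0 (r s : space3 R) : 0 <= chord_dist r s.
Proof. exact: sqrtr_ge0. Qed.

Lemma chord_distC (r s : space3 R) : chord_dist r s = chord_dist s r.
Proof.
by rewrite /chord_dist -(sqrrN (r.1.1 - _)) -(sqrrN (r.1.2 - _))
  -(sqrrN (r.2 - _)) !opprB.
Qed.

(** Minkowski's inequality in dimension three: the Cauchy-Schwarz defect is a sum
    of three squares by Lagrange's identity. *)
Lemma chord_dist_triangle (s r t : space3 R) :
  chord_dist r t <= chord_dist r s + chord_dist s t.
Proof.
rewrite /chord_dist.
have -> : r.1.1 - t.1.1 = (r.1.1 - s.1.1) + (s.1.1 - t.1.1) by ring.
have -> : r.1.2 - t.1.2 = (r.1.2 - s.1.2) + (s.1.2 - t.1.2) by ring.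
have -> : r.2 - t.2 = (r.2 - s.2) + (s.2 - t.2) by ring.
move: (r.1.1 - s.1.1) (r.1.2 - s.1.2) (r.2 - s.2)
  (s.1.1 - t.1.1) (s.1.2 - t.1.2) (s.2 - t.2) => a b c x y z.
set u := a ^+ 2 + b ^+ 2 + c ^+ 2; set v := x ^+ 2 + y ^+ 2 + z ^+ 2.
have u0 : 0 <= u by rewrite !addr_ge0 ?sqr_ge0.
have v0 : 0 <= v by rewrite !addr_ge0 ?sqr_ge0.
have cs : a * x + b * y + c * z <= Num.sqrt u * Num.sqrt v.
  rewrite -sqrtrM// (le_trans (ler_norm _))// -sqrtr_sqr ler_wsqrtr//.
  rewrite -subr_ge0.
  have -> : u * v - (a * x + b * y + c * z) ^+ 2 =
    (a * y - b * x) ^+ 2 + (a * z - c * x) ^+ 2 + (b * z - c * y) ^+ 2.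
    by rewrite /u /v; ring.
  by rewrite !addr_ge0 ?sqr_ge0.
rewrite -[leRHS]ger0_norm ?addr_ge0 ?sqrtr_ge0// -sqrtr_sqr ler_wsqrtr//.
rewrite [leRHS]sqrrD !sqr_sqrtr//.
have -> : (a + x) ^+ 2 + (b + y) ^+ 2 + (c + z) ^+ 2 =
  u + (a * x + b * y + c * z) *+ 2 + v by rewrite /u /v; ring.
by rewrite lerD2r lerD2l lerMn2r.
Qed.

End borel.

(** * Jensen's inequality for powers *)

Section jensen.
Local Open Scope ereal_scope.

(** For q > 1 this is Hoelder's inequality between [f] and the constant 1, whose
    norm for the conjugate exponent is 1 under a probability. *)
Lemma jensen_powR d (T : measurableType d) (R : realType)
    (mu : probability T R) (f : T -> R) (q : R) :
  measurable_fun setT f -> (forall x, 0 <= f x)%R -> (1 <= q)%R ->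
  (\int[mu]_x (f x)%:E) `^ q <= \int[mu]_x (f x `^ q)%:E.
Proof.
move=> mf f0; rewrite le_eqVlt => /predU1P[<-|q1].
  rewrite poweRe1; last by apply: integral_ge0 => x _; rewrite lee_fin.
  by under [leRHS]eq_integral do rewrite powRr1//.
have q0 : (0 < q)%R := lt_trans ltr01 q1.
have p0 : (0 < 1 - q^-1)%R by rewrite subr_gt0 invf_lt1.
have cst1 : measurable_fun setT (cst 1%R : T -> R) by [].
have := @hoelder _ _ _ mu f (cst 1%R) q (1 - q^-1)^-1 mf cst1 q0.
rewrite invr_gt0 invrK (addrC q^-1)%R subrK => /(_ p0 erefl).
have mu1 : Lnorm mu (1 - q^-1)^-1%:E (EFin \o cst 1%R) = 1.
  by rewrite Lnorm_cst1; exact: etrans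
    (congr1 (poweR^~ _) (probability_setT mu)) (poweR1r _).
rewrite Lnorm1 mu1 mule1.
move=> h; have {}h : \int[mu]_x (f x)%:E <= Lnorm mu q%:E (EFin \o f).
  by move: h; under eq_integral do rewrite /= mulr1 ger0_norm//.
have I0 : 0 <= \int[mu]_x (f x)%:E by apply: integral_ge0 => x _; rewrite lee_fin.
have := @gt0_ler_poweR R q (ltW q0) _ _ _ _ h.
rewrite !in_itv/= !leey !andbT Lnorm_ge0 => /(_ I0 erefl) /le_trans; apply.
rewrite powR_Lnorm ?gt_eqF//; under eq_integral do rewrite /= ger0_norm//.
by [].
Qed.

End jensen.

(** * Couplings of the projected laws *)

Section coupling_bounds.
Context {R : realType}.
Implicit Types (P : stoch_system R) (w q : R).

Lemma measurable_proj_support P w : compact (resp_support P w) ->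
  measurable (proj_support P w).
Proof.
move=> cP; apply: compact_measurable3; apply: continuous_compact cP.
by apply: continuous_subspaceT; exact: continuous_inv_stereo.
Qed.

(** Pulled back to the plane, the complement of the projected support avoids the
    support of the response. *)
Lemma proj_distr_supportC P w : compact (resp_support P w) ->
  proj_distr P w (~` proj_support P w) = 0%E.
Proof.
move=> /measurable_proj_support mS.
have mpre : measurable (@inv_stereo R @^-1` (~` proj_support P w)).
  by rewrite -[X in measurable X]setTI;
    apply: measurable_inv_stereo => //; exact: measurableC.
apply: (measure_negligible (mu := resp_distr P w)) => //.
apply: negligibleS (negligible_support_setC (resp_distr P w)).
by move=> c nSc Sc; apply: nSc; exists c.
Qed.

Local Open Scope ereal_scope.

(** Outside [K `*` L] one of the two coordinates misses [K] or [L], and by the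
    marginal conditions each of these two events is null. *)
Lemma coupling_integral_setX (mu nu : probability (space3 R) R)
    (pi : probability (space3 R * space3 R)%type R) (K L : set (space3 R))
    (f : space3 R * space3 R -> \bar R) :
  couplings mu nu pi -> measurable K -> measurable L ->
  mu (~` K) = 0 -> nu (~` L) = 0 ->
  measurable_fun setT f -> (forall x, 0 <= f x) ->
  \int[pi]_(x in K `*` L) f x = \int[pi]_x f x.
Proof.
move=> cpi mK mL muK nuL mf f0.
have mKL : measurable (K `*` L) by exact: measurableX.
rewrite [RHS](@ge0_negligible_integral _ _ _ _ _ (~` (K `*` L)))//.
- by rewrite setDE setCK setTI.
- exact: measurableC.
apply: measure_negligible; first exact: measurableC.
have nK : pi.-negligible (fst @^-1` (~` K)).
  exists (fst @^-1` (~` K)); split => //.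
    by rewrite -[X in measurable X]setTI; apply: measurable_fst => //;
      exact: measurableC.
  by have [+ _] := cpi _ (measurableC mK); rewrite /pushforward => ->.
have nL : pi.-negligible (snd @^-1` (~` L)).
  exists (snd @^-1` (~` L)); split => //.
    by rewrite -[X in measurable X]setTI; apply: measurable_snd => //;
      exact: measurableC.
  by have [_ +] := cpi _ (measurableC mL); rewrite /pushforward => ->.
apply: negligibleS (negligibleU nK nL) => -[x y] /not_andP[]; by [left|right].
Qed.

(** The mean of [delta_nom] may be infinite for an arbitrary law [pi]; the
    positive part in [delta_dev] is then zero. *)
Lemma delta_dev_le q (Rbar1 Rbar2 : space3 R)
    (pi : probability (space3 R * space3 R)%type R) : (1 <= q)%R ->
  delta_dev q Rbar1 Rbar2 pi <= \int[pi]_x (chord_dist x.1 x.2 `^ q)%:E.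
Proof.
move=> q1; have q0 : (0 <= q)%R := le_trans ler01 q1.
have m1 : measurable_fun setT
    (fun x : space3 R * space3 R => chord_dist x.1 x.2).
  by apply: measurable_chord_dist; [exact: measurable_fst|exact: measurable_snd].
have mnom : measurable_fun setT (delta_nom Rbar1 Rbar2).
  by apply: measurable_funD; exact: measurable_chord_dist.
have nom0 x : (0 <= delta_nom Rbar1 Rbar2 x)%R.
  by rewrite addr_ge0 ?chord_dist_ge0.
apply: le_trans (jensen_powR pi m1 (fun=> chord_dist_ge0 _ _) q1).
have I0 : 0 <= \int[pi]_x (chord_dist x.1 x.2)%:E.
  by apply: integral_ge0 => x _; rewrite lee_fin chord_dist_ge0.
apply: (gt0_ler_poweR q0); rewrite ?in_itv/= ?leey ?andbT ?le_max ?lexx//.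
rewrite ge_max I0/= unlock.
have E0 : 0 <= \int[pi]_x (delta_nom Rbar1 Rbar2 x)%:E.
  by apply: integral_ge0 => x _; rewrite lee_fin.
have dE : (chord_dist Rbar1 Rbar2)%:E <= \int[pi]_x (chord_dist x.1 x.2)%:E +
    \int[pi]_x (delta_nom Rbar1 Rbar2 x)%:E.
  rewrite -ge0_integralD//; first last.
  - exact/measurable_EFinP.
  - by move=> x _; rewrite lee_fin.
  - exact/measurable_EFinP.
  - by move=> x _; rewrite lee_fin chord_dist_ge0.
  rewrite -[leLHS]mule1 -(probability_setT pi) -integral_cst//.
  apply: ge0_le_integral => //.
  - by move=> x _; rewrite lee_fin chord_dist_ge0.
  - by apply: emeasurable_funD; exact/measurable_EFinP.
  move=> x _; rewrite -EFinD lee_fin /delta_nom.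
  apply: le_trans (chord_dist_triangle x.1 _ _) _.
  rewrite chord_distC addrCA lerD2l.
  exact: chord_dist_triangle.
(* In extended arithmetic the mean can be subtracted from both sides only when it
   is finite; otherwise the difference is minus infinity. *)
move: E0 dE; case: (\int[pi]_x _%:E) => [e _|_|//].
  by rewrite leeBlDr.
by move=> _; rewrite leNye.
Qed.

End coupling_bounds.

Theorem mainTheorem2 (R : realType) (q : R) (hq : 1 <= q)
  (P1 P2 : stoch_system R)
  (convex_supp1 : forall w, w \in @frequencies R ->
    convex_set (resp_support P1 w : set (Rcomplex R)))
  (convex_supp2 : forall w, w \in @frequencies R ->
    convex_set (resp_support P2 w : set (Rcomplex R)))
  (compact_supp1 : forall w, w \in @frequencies R ->
    compact (resp_support P1 w))
  (compact_supp2 : forall w, w \in @frequencies R ->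
    compact (resp_support P2 w))
  (Pbar1 Pbar2 : R -> R[i]) :
  (ereal_sup [set ereal_inf
     [set delta_dev q (inv_stereo (Pbar1 w)) (inv_stereo (Pbar2 w)) pi
     | pi in proj_couplings P1 P2 w] | w in @frequencies R]
   <= type_q_dist q P1 P2)%E.
Proof.
apply: ge_ereal_sup => _ [w w0 <-].
apply: le_trans (ereal_sup_ubound (ex_intro2 _ _ w w0 erefl)).
apply: le_ereal_inf_tmp => _ [pi cpi <-].
apply: (le_trans (ereal_inf_lbound (ex_intro2 _ _ pi cpi erefl))).
have c1 := compact_supp1 _ (mem_set w0); have c2 := compact_supp2 _ (mem_set w0).
rewrite (coupling_integral_setX cpi) ?proj_distr_supportC//.
- exact: delta_dev_le.
- exact: measurable_proj_support.
- exact: measurable_proj_support.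
- apply/measurable_EFinP; apply: (measurableT_comp (measurable_powR q)).
  exact: measurable_chord_dist.
- by move=> x; rewrite lee_fin powR_ge0.
Qed.
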